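(* Let $(R,\mathfrak m)$ be a Noetherian local ring of dimension $>0$, and let $H=\bigcup_{n>0}\left((0):_R\mathfrak m^n\right)$ be the zeroth local cohomology of $R$. Let $I$ be an ideal of $R$ with $I\supseteq H$. If $I/H$ is a trace ideal in $R/H$ containing a non-zerodivisor of $R/H$, then $I$ is a trace ideal in $R$. In particular, if the set $\mathrm{Tr}(R)$ of trace ideals of $R$ is finite, then the set $\mathrm{reg}\text{-}\mathrm{Tr}(R/H)$ of regular trace ideals of $R/H$ is also finite.
   Context: All rings are commutative. For a ring $R$ and an $R$-module $M$, the trace ideal of $M$ is $\mathrm{tr}_R(M)=\sum_{f\in\operatorname{Hom}_R(M,R)}\operatorname{Im} f$. An ideal $I$ of $R$ is a trace ideal in $R$ if $I=\mathrm{tr}_R(M)$ for some $R$-module $M$ (equivalently, $I=\mathrm{tr}_R(I)$). An ideal is regular if it contains a non-zerodivisor of the ring. $\mathrm{Tr}(R)$ is the set of all trace ideals in $R$ and $\mathrm{reg}\text{-}\mathrm{Tr}(R)$ is the set of all regular trace ideals in $R$. *)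

(* Defs.v *)
From HB Require Import structures.
From mathcomp Require Import all_boot all_order all_algebra.
From mathcomp Require Import boolp classical_sets functions cardinality.

Set Implicit Arguments.
Unset Strict Implicit.
Unset Printing Implicit Defensive.

Import GRing.Theory.

Local Open Scope classical_set_scope.
Local Open Scope quotient_scope.
Local Open Scope ring_scope.

Section Ideals.
Context {R : comNzRingType}.
Implicit Types (I J A P m : set R) (x y : R) (n : nat).

(* Ideals may be improper, in contrast with [idealr R]. *)
Definition is_ideal I := I 0 /\ forall a x y, I x -> I y -> I (a * x + y).

Definition is_prime P :=
  [/\ is_ideal P, ~ P 1 & forall x y, P (x * y) -> P x \/ P y].

Definition is_maximal m :=
  [/\ is_ideal m, ~ m 1 &
      forall J, is_ideal J -> m `<=` J -> J = m \/ J = [set: R]].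

Definition ideal_gen A : set R := smallest is_ideal A.

Definition ideal_mul I J : set R := ideal_gen [set x * y | x in I & y in J].

Definition ideal_exp I n : set R := iter n (ideal_mul I) [set: R].

(* The colon ideal I :_R A. *)
Definition colon I A : set R := [set x | forall y, A y -> I (x * y)].

(* [GRing.lreg a] says that multiplication by a is injective, i.e. that a is
   a non-zerodivisor. *)
Definition is_regular_ideal I := is_ideal I /\ exists2 a, I a & GRing.lreg a.

(* H = \bigcup_(n > 0) (0 :_R m^n) *)
Definition local_cohomology0 m : set R :=
  \bigcup_(n in [set n | (0 < n)%N]) colon [set 0] (ideal_exp m n).

End Ideals.

Definition noetherian (R : comNzRingType) :=
  forall I : set R, is_ideal I -> exists2 A, finite_set A & I = ideal_gen A.

Definition is_local (R : comNzRingType) (m : set R) :=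
  is_maximal m /\ forall m' : set R, is_maximal m' -> m' = m.

(* dim R >= n: there is a chain p_0 < p_1 < ... < p_n of prime ideals. The
   Krull dimension is the supremum of such n, so dim R > 0 is
   [krull_dim_ge R 1]. *)
Definition krull_dim_ge (R : comNzRingType) (n : nat) :=
  exists p : nat -> set R,
    (forall i, (i <= n)%N -> is_prime (p i)) /\
    (forall i, (i < n)%N -> p i `<` p i.+1).

(* The sum of the ideals Im f consists of the finite sums of elements f u. *)
Definition trace (R : comNzRingType) (M : lmodType R) : set R :=
  [set x | exists (n : nat) (f : 'I_n -> {linear M -> R^o}) (u : 'I_n -> M),
     x = \sum_(i < n) f i (u i)].

Definition is_trace_ideal (R : comNzRingType) (I : set R) :=
  is_ideal I /\ exists M : lmodType R, I = trace M.

Definition Tr (R : comNzRingType) : set (set R) :=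
  [set I | is_trace_ideal I].

Definition regTr (R : comNzRingType) : set (set R) :=
  [set I | is_trace_ideal I /\ is_regular_ideal I].

Arguments Tr R : clear implicits.
Arguments regTr R : clear implicits.

Section LocalCohomology.
Context {R : comNzRingType}.
Implicit Types (I J A m : set R).

Lemma ideal_gen_ideal A : is_ideal (ideal_gen A).
Proof.
split=> [J [[]]//|a x y Ix Iy J JA].
by case: (JA) => -[_ idJ] _; apply: idJ; [exact: Ix|exact: Iy].
Qed.

Lemma idealMl I a x : is_ideal I -> I x -> I (a * x).
Proof. by move=> [I0 idI] Ix; rewrite -[a * x]addr0; exact: idI. Qed.

Lemma ideal_exp_ideal I n : is_ideal (ideal_exp I n).
Proof. by case: n => [|n]; [split|exact: ideal_gen_ideal]. Qed.

Lemma ideal_exp_sub I n k : ideal_exp I (n + k) `<=` ideal_exp I k.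
Proof.
elim: n => [|n IHn]; first by [].
apply: subset_trans IHn => x; apply; split; first exact: ideal_exp_ideal.
move=> _ [a _ [b Jb <-]]; exact: idealMl (ideal_exp_ideal _ _) Jb.
Qed.

Lemma ideal_exp_expr I n x : I x -> ideal_exp I n (x ^+ n).
Proof.
move=> Ix; elim: n => [//|n IHn]; rewrite exprS => J [_]; apply.
by exists x => //; exists (x ^+ n).
Qed.

Lemma local_cohomology0_ideal m : is_ideal (local_cohomology0 m).
Proof.
split; first by exists 1%N => // y _; rewrite mul0r.
move=> a x y [n n0 Hx] [k k0 Hy]; exists (n + k)%N; first by rewrite /= addn_gt0 n0.
move=> z Hz; have -> : (a * x + y) * z = a * (x * z) + y * z.
  by rewrite mulrDl mulrA.
rewrite (Hy z (ideal_exp_sub Hz)) (Hx z) ?mulr0 ?addr0 //.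
by rewrite addnC in Hz; exact: ideal_exp_sub Hz.
Qed.

Lemma local_cohomology0_proper m :
  is_local m -> krull_dim_ge R 1 -> ~ local_cohomology0 m 1.
Proof.
move=> [[_ _ maxm] _] [p [pP ltp]] [n n0 Hn].
have [_ _ prime0] := pP 0%N isT; have [id1 proper1 _] := pP 1%N isT.
have mp0 : m `<=` p 0%N.
  move=> x mx; have : p 0%N (x ^+ n).
    rewrite -[x ^+ n]mul1r (Hn _ (ideal_exp_expr n mx)).
    by have [[]] := pP 0%N isT.
  elim: (n) => [|k IHk]; last by rewrite exprS => /prime0[].
  by rewrite expr0; have [] := pP 0%N isT.
have [p01 np10] := ltp 0%N isT.
case: (maxm _ id1 (subset_trans mp0 p01)) => [E|E].
  by apply: np10; rewrite E.
by apply: proper1; rewrite E.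
Qed.

Lemma local_cohomology0_idealr_closed m :
  is_local m -> krull_dim_ge R 1 ->
  idealr_closed (fun x => `[< local_cohomology0 m x >]).
Proof.
move=> mloc dimR; have [H0 HD] := local_cohomology0_ideal m; split.
- exact/asboolP.
- exact/asboolP/local_cohomology0_proper.
- by move=> a x y /asboolP Hx /asboolP Hy; apply/asboolP/HD.
Qed.

Definition local_cohomology0_idealr m (mloc : is_local m)
    (dimR : krull_dim_ge R 1) : idealr R :=
  HB.pack_for (idealr R) (fun x => `[< local_cohomology0 m x >])
    (isIdealr.Build R _ (local_cohomology0_idealr_closed mloc dimR)).

(* R / H, as a nontrivial ring; it depends on the proofs [mloc] and [dimR]
   only because H has to be shown to be a proper ideal. *)
Definition quot_local_cohomology0 m (mloc : is_local m)
    (dimR : krull_dim_ge R 1) : comNzRingType :=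
  {ideal_quot (local_cohomology0_idealr mloc dimR)}.

(* I / H, the image of I under the canonical surjection R -> R / H *)
Definition ideal_mod_local_cohomology0 m (mloc : is_local m)
    (dimR : krull_dim_ge R 1) I : set (quot_local_cohomology0 mloc dimR) :=
  [set \pi_({ideal_quot (local_cohomology0_idealr mloc dimR)}) x | x in I].

End LocalCohomology.

Arguments ideal_mod_local_cohomology0 {R} [m] mloc dimR I _.

(* Main.v *)
Require Import Defs.
From HB Require Import structures.
From mathcomp Require Import all_boot all_order all_algebra.
From mathcomp Require Import boolp classical_sets functions cardinality.

(** An ideal I is a trace ideal if and only if every linear map from I to R has
its image in I ([is_trace_idealP]). Let f : I -> R be such a map, and let H be
contained in I. An element of H is killed by a power of the maximal ideal, and
linear maps preserve this, so f maps H into H ([linear_local_cohomology0]) and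
induces an (R / H)-linear map from I / H to R / H ([induced]). If I / H is a
trace ideal, the induced map has its image in I / H, which says that f(I) is
contained in I + H = I; hence I is a trace ideal ([trace_ideal_lift]).

For the finiteness statement, every ideal J of R / H is the image of its
preimage in R, and this preimage contains H. If J is a trace ideal, so is its
preimage by the first part, so the trace ideals of R / H are among the images
of the finitely many trace ideals of R. *)

Set Implicit Arguments.
Unset Strict Implicit.
Unset Printing Implicit Defensive.

Import GRing.Theory.

Local Open Scope classical_set_scope.
Local Open Scope quotient_scope.
Local Open Scope ring_scope.

(** The proof [idI] is an argument so that the closure properties of this
predicate, hence the module structure below, can be found by inference. *)
Definition ideal_pred (R : comNzRingType) (I : set R) (idI : is_ideal I) :
  {pred R^o} := fun x => `[< I x >].

Lemma ideal_predP (R : comNzRingType) (I : set R) (idI : is_ideal I) x :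
  reflect (I x) (x \in ideal_pred idI).
Proof. exact: asboolP. Qed.

Lemma ideal_pred_submod (R : comNzRingType) (I : set R) (idI : is_ideal I) :
  submod_closed (ideal_pred idI).
Proof.
have [I0 ID] := idI.
split=> [|a x y /(ideal_predP idI) Ix /(ideal_predP idI) Iy].
  exact/ideal_predP.
exact/ideal_predP/ID.
Qed.

HB.instance Definition _ (R : comNzRingType) (I : set R) (idI : is_ideal I) :=
  GRing.isSubmodClosed.Build R R^o (ideal_pred idI) (ideal_pred_submod idI).

Definition ideal_module (R : comNzRingType) (I : set R) (idI : is_ideal I) :=
  {x : R^o | x \in ideal_pred idI}.

HB.instance Definition _ (R : comNzRingType) (I : set R) (idI : is_ideal I) :=
  SubChoice.on (ideal_module idI).
HB.instance Definition _ (R : comNzRingType) (I : set R) (idI : is_ideal I) :=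
  [SubChoice_isSubLmodule of ideal_module idI by <:].

Section Trace.
Context {R : comNzRingType}.
Implicit Types (I m : set R) (M : lmodType R).

Lemma idealD I x y : is_ideal I -> I x -> I y -> I (x + y).
Proof. by move=> [_ ID] Ix Iy; rewrite -[x]mul1r; exact: ID. Qed.

Lemma ideal_sum I n (F : 'I_n -> R) :
  is_ideal I -> (forall i, I (F i)) -> I (\sum_(i < n) F i).
Proof.
move=> idI IF; elim/big_ind: _ => //; first by case: idI.
by move=> x y; exact: idealD.
Qed.

Lemma trace_apply M (f : {linear M -> R^o}) u : trace M (f u).
Proof. by exists 1%N, (fun=> f), (fun=> u); rewrite big_ord1. Qed.

Lemma corestr_linear I (idI : is_ideal I) M (g : {linear M -> R^o})
    (gI : forall v, g v \in ideal_pred idI) :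
  linear (fun v => Sub (g v) (gI v) : ideal_module idI).
Proof.
by move=> a v w; apply: val_inj; rewrite [RHS]linearP !SubK linearP.
Qed.

(** If I is the trace of M, each element of I is a sum of values g(v) of linear
forms g : M -> R, and f \o g is again a linear form on M, so f(g(v)) lies in
the trace of M. Conversely, if all linear forms on I take their values in I,
then I is its own trace, the inclusion of I in R giving all of I. *)
Lemma is_trace_idealP I (idI : is_ideal I) :
  is_trace_ideal I <->
  forall (f : {linear ideal_module idI -> R^o}) u, I (f u).
Proof.
split=> [[_ [M IM]] f u|fI].
  have gI (g : {linear M -> R^o}) v : g v \in ideal_pred idI.
    by apply/(ideal_predP idI); rewrite IM; exact: trace_apply.
  have : I (val u) by apply/(ideal_predP idI)/valP.
  rewrite {1}IM => -[n [g [v uE]]].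
  have -> : u = \sum_(i < n) Sub (g i (v i)) (gI (g i) (v i)).
    by apply: val_inj; rewrite raddf_sum.
  rewrite raddf_sum; apply: ideal_sum => // i.
  pose G := GRing.isLinear.Build _ _ _ _ _ (corestr_linear (gI (g i))).
  pose g' : {linear M -> ideal_module idI} :=
    HB.pack (fun v => Sub (g i v) (gI (g i) v) : ideal_module idI) G.
  by rewrite {1}IM; exact: (trace_apply (f \o g')).
split=> //; exists (ideal_module idI).
apply/seteqP; split=> [x Ix|_ [n [f [u ->]]]].
  have xI : x \in ideal_pred idI by apply/(ideal_predP idI).
  exact: (trace_apply (val : {linear ideal_module idI -> R^o}) (Sub x xI)).
exact: ideal_sum.
Qed.

(** If an element u is killed by the n-th power of m, so is f(u). *)
Lemma linear_local_cohomology0 m I (idI : is_ideal I)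
    (f : {linear ideal_module idI -> R^o}) u :
  local_cohomology0 m (val u) -> local_cohomology0 m (f u).
Proof.
move=> [n n0 Hu]; exists n => // y my.
rewrite mulrC -[y * f u]/(y *: f u) -linearZ.
suff -> : y *: u = 0 by rewrite linear0.
by apply: val_inj; rewrite linearZ; exact: etrans (mulrC _ _) (Hu y my).
Qed.

End Trace.

Section Quotient.
Context {R : comNzRingType} {m : set R}.
Variables (mloc : is_local m) (dimR : krull_dim_ge R 1).
Implicit Types (I : set R).
Local Notation H := (local_cohomology0 m).
Local Notation S := (quot_local_cohomology0 mloc dimR).

(** The canonical surjection, typed so that its values are in the carrier of
the ring R / H and not in the underlying quotient type: the lemmas on ring
morphisms then apply to it. *)
Definition proj : {rmorphism R -> S} := \pi_S.
Definition lift (s : S) : R := repr s.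

Lemma liftK : cancel lift proj.
Proof. exact: reprK. Qed.

Lemma proj_eqP (x y : R) : proj x = proj y <-> H (x - y).
Proof.
split=> [/eqP|Hxy].
  by rewrite -Quotient.idealrBE => /asboolP.
by apply/eqP; rewrite -Quotient.idealrBE; apply/asboolP.
Qed.

(** As I contains H, it is the full preimage of I / H. *)
Lemma proj_mem I (x : R) : is_ideal I -> H `<=` I ->
  ideal_mod_local_cohomology0 mloc dimR I (proj x) <-> I x.
Proof.
move=> idI HI; split=> [[y Iy /esym/proj_eqP/HI Ixy]|Ix]; last by exists x.
by rewrite -(subrK y x); exact: idealD.
Qed.

Lemma ideal_mod_ideal I :
  is_ideal I -> is_ideal (ideal_mod_local_cohomology0 mloc dimR I).
Proof.
move=> [I0 ID]; split; first by exists 0 => //; rewrite raddf0.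
move=> a _ _ [x Ix <-] [y Iy <-]; exists (lift a * x + y); first exact: ID.
by rewrite rmorphD rmorphM liftK.
Qed.

Lemma preimage_proj_ideal (J : set S) : is_ideal J -> is_ideal (proj @^-1` J).
Proof.
move=> [J0 JD]; split; first by rewrite /preimage /= raddf0.
by move=> a x y Jx Jy; rewrite /preimage /= rmorphD rmorphM; exact: JD.
Qed.

Section Induced.
Variables (I : set R) (idI : is_ideal I) (HI : H `<=` I).
Local Notation idIH := (ideal_mod_ideal idI).
Variable f : {linear ideal_module idI -> R^o}.

Lemma lift_ideal_mod (v : ideal_module idIH) :
  lift (val v) \in ideal_pred idI.
Proof.
apply/ideal_predP/(proj_mem _ idI HI); rewrite liftK.
exact/(ideal_predP idIH)/valP.
Qed.

(** The map I / H -> R / H induced by f. It is computed on a chosen preimage in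
I; [inducedE] shows that the choice does not matter. *)
Definition induced (v : ideal_module idIH) : S^o :=
  proj (f (Sub (lift (val v)) (lift_ideal_mod v))).

Lemma inducedE (v : ideal_module idIH) u :
  proj (val u) = val v -> induced v = proj (f u).
Proof.
move=> uv; apply/proj_eqP; rewrite -raddfB; apply: linear_local_cohomology0.
by rewrite raddfB /=; apply/proj_eqP; rewrite liftK.
Qed.

Lemma induced_linear : linear induced.
Proof.
move=> a v w.
pose r v : ideal_module idI := Sub (lift (val v)) (lift_ideal_mod v).
rewrite (inducedE (u := lift a *: r v + r w)).
  by rewrite linearP rmorphD rmorphM liftK.
by rewrite !linearP /= rmorphD rmorphM !liftK.
Qed.

End Induced.

Lemma trace_ideal_lift I : is_ideal I -> H `<=` I ->
  is_trace_ideal (ideal_mod_local_cohomology0 mloc dimR I) -> is_trace_ideal I.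
Proof.
move=> idI HI /(is_trace_idealP (ideal_mod_ideal idI)) trIH.
apply/(is_trace_idealP idI) => f u; apply/(proj_mem _ idI HI).
have uIH : proj (val u) \in ideal_pred (ideal_mod_ideal idI).
  by apply/ideal_predP/proj_mem => //; exact/(ideal_predP idI)/valP.
rewrite -(inducedE HI f (v := Sub (proj (val u)) uIH)) //.
pose G := GRing.isLinear.Build _ _ _ _ _ (induced_linear HI f).
pose g : {linear ideal_module (ideal_mod_ideal idI) -> S^o} :=
  HB.pack (induced HI f) G.
exact: (trIH g).
Qed.

Lemma ideal_modK (J : set S) :
  ideal_mod_local_cohomology0 mloc dimR (proj @^-1` J) = J.
Proof.
by apply/seteqP; split=> [_ [x Jx <-] //|s Js]; exists (lift s);
  rewrite /preimage /= liftK.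
Qed.

Lemma local_cohomology0_sub_preimage (J : set S) :
  is_ideal J -> H `<=` proj @^-1` J.
Proof.
move=> [J0 _] x Hx; rewrite /preimage /=.
suff -> : proj x = 0 by [].
by rewrite -(raddf0 proj); apply/proj_eqP; rewrite subr0.
Qed.

End Quotient.

Theorem proposition2p3 (R : comNzRingType) (m : set R)
    (Rnoeth : noetherian R) (mloc : is_local m) (dimR : krull_dim_ge R 1) :
  (forall I : set R, is_ideal I -> local_cohomology0 m `<=` I ->
     is_trace_ideal (ideal_mod_local_cohomology0 mloc dimR I) ->
     (exists2 a, ideal_mod_local_cohomology0 mloc dimR I a & GRing.lreg a) ->
     is_trace_ideal I) /\
  (finite_set (Tr R) -> finite_set (regTr (quot_local_cohomology0 mloc dimR))).
Proof.
split=> [I idI HI trIH _|finTr]; first exact: trace_ideal_lift trIH.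
have := finite_image (ideal_mod_local_cohomology0 mloc dimR) finTr.
apply: sub_finite_set => J [trJ _]; rewrite -(ideal_modK J); apply: imageP.
apply: (trace_ideal_lift (mloc := mloc) (dimR := dimR)).
- exact: preimage_proj_ideal trJ.1.
- exact: local_cohomology0_sub_preimage trJ.1.
- by rewrite ideal_modK.
Qed.
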